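(* Let $(X,d)$ be a metric space which is not a singleton and let $(a_n)_{n\in\mathbb{N}^*}$ be a bounded sequence of positive reals. Let $\tau_T$ be the Tychonoff topology on $\ell_\infty(X)$ and $\tau_{d_{s,(a_n)}}$ the topology induced by the metric $d_{s,(a_n)}$. Then $\tau_T=\tau_{d_{s,(a_n)}}$ if and only if $a_n\to 0$ and $(X,d)$ is bounded.
   Context: $\mathbb{N}^*=\{0,1,2,\dots\}$. For a metric space $(X,d)$, $\ell_\infty(X)$ denotes the set of all bounded sequences $(x_n)_{n\in\mathbb{N}^*}$ of elements of $X$. For a real sequence $(a_n)$ and $x=(x_n),y=(y_n)\in\ell_\infty(X)$, $d_{s,(a_n)}(x,y):=\sup\{a_n d(x_n,y_n):n\in\mathbb{N}^*\}$ (a metric on $\ell_\infty(X)$ when $(a_n)$ is bounded and positive). The Tychonoff topology on $\ell_\infty(X)$ is the subspace topology induced from the product topology on $\prod_{n\in\mathbb{N}^*}X$, i.e. the topology of coordinatewise convergence. *)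

(* Defs.v *)
From Stdlib Require Import Reals List.
Open Scope R_scope.

Definition is_metric {X : Type} (d : X -> X -> R) : Prop :=
  (forall x y, 0 <= d x y) /\
  (forall x y, d x y = 0 <-> x = y) /\
  (forall x y, d x y = d y x) /\
  (forall x y z, d x z <= d x y + d y z).

Definition metric_bounded {X : Type} (d : X -> X -> R) : Prop :=
  exists M : R, forall x y, d x y <= M.

Definition metric_open {X : Type} (d : X -> X -> R) (O : X -> Prop) : Prop :=
  forall p, O p -> exists r, 0 < r /\ forall q, d p q < r -> O q.

Definition bounded_seq {X : Type} (d : X -> X -> R) (x : nat -> X) : Prop :=
  exists M : R, forall n m, d (x n) (x m) <= M.

Definition linf {X : Type} (d : X -> X -> R) : Type :=
  { x : nat -> X | bounded_seq d x }.

(* open sets of the product (Tychonoff) topology on prod_{n} X: generated by the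
   base of finite intersections of preimages pi_i^{-1}(O) with O open in X *)
Definition product_open {X : Type} (d : X -> X -> R) (U : (nat -> X) -> Prop) : Prop :=
  forall x, U x ->
    exists F : list (nat * (X -> Prop)),
      (forall iO, In iO F -> metric_open d (snd iO) /\ snd iO (x (fst iO))) /\
      (forall y : nat -> X,
          (forall iO, In iO F -> snd iO (y (fst iO))) -> U y).

Definition tychonoff_open {X : Type} (d : X -> X -> R) (V : linf d -> Prop) : Prop :=
  exists U : (nat -> X) -> Prop, product_open d U /\
    forall x : linf d, V x <-> U (proj1_sig x).

(* the set {a_n d(x_n,y_n) : n} whose supremum is d_{s,(a_n)}(x,y) *)
Definition ds_set {X : Type} (d : X -> X -> R) (a : nat -> R) (x y : nat -> X) : R -> Prop :=
  fun t => exists n, t = a n * d (x n) (y n).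

Definition ds_is {X : Type} (d : X -> X -> R) (a : nat -> R) (x y : nat -> X) (s : R) : Prop :=
  is_lub (ds_set d a x y) s.

Definition ds_open {X : Type} (d : X -> X -> R) (a : nat -> R) (V : linf d -> Prop) : Prop :=
  forall x : linf d, V x -> exists r, 0 < r /\
    forall y : linf d,
      (exists s, ds_is d a (proj1_sig x) (proj1_sig y) s /\ s < r) -> V y.

(* Main.v *)
Require Import Defs.
From Stdlib Require Import Reals List Lra Lia Classical.
Open Scope R_scope.

(* A basic Tychonoff neighbourhood constrains finitely many coordinates, each to a
   d-ball; shrinking the weighted radius by the positive weights of those finitely many
   coordinates puts a d_s-ball inside it, so Tychonoff-open sets are always d_s-open.
   Conversely, when a_n -> 0 and d <= M, the coordinates n >= N contribute at most
   a_n M < r/2 to d_s, so a d_s-ball of radius r contains the basic neighbourhood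
   constraining only the coordinates n < N.  If either condition fails there are a
   point c and rho > 0 such that, beyond every index N, some coordinate can be moved
   to weighted distance >= rho from c; the d_s-ball of radius rho around the constant
   sequence c then contains no basic neighbourhood, which constrains only finitely
   many coordinates. *)

Section SupMetricTopology.

Context {X : Type} (d : X -> X -> R) (a : nat -> R).
Hypothesis Hd : is_metric d.
Hypothesis Hapos : forall n, 0 < a n.

Lemma metric_refl (x : X) : d x x = 0.
Proof. destruct Hd as [_ [Hsep _]]. now apply Hsep. Qed.

Lemma metric_pos (x y : X) : x <> y -> 0 < d x y.
Proof.
  destruct Hd as [Hge [Hsep _]]. intros Hxy.
  destruct (Hge x y) as [Hlt | Heq]; [exact Hlt |].
  exfalso. apply Hxy, Hsep. now symmetry.
Qed.

Lemma metric_open_ball (c : X) (rho : R) : metric_open d (fun q => d c q < rho).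
Proof.
  destruct Hd as [_ [_ [_ Htri]]]. intros p Hp. exists (rho - d c p). split; [lra |].
  intros q Hq. pose proof (Htri c p q). lra.
Qed.

Lemma ds_is_ge (x y : nat -> X) (s : R) (n : nat) :
  ds_is d a x y s -> a n * d (x n) (y n) <= s.
Proof. intros [Hub _]. apply Hub. now exists n. Qed.

Lemma ds_is_exists_le (x y : nat -> X) (b : R) :
  (forall n, a n * d (x n) (y n) <= b) -> exists s, ds_is d a x y s /\ s <= b.
Proof.
  intros Hb.
  destruct (completeness (ds_set d a x y)) as [s Hs].
  - exists b. intros t [n ->]. apply Hb.
  - exists (a 0%nat * d (x 0%nat) (y 0%nat)). now exists 0%nat.
  - exists s. split; [exact Hs |]. apply (proj2 Hs). intros t [n ->]. apply Hb.
Qed.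

Lemma ds_is_refl (x : nat -> X) : ds_is d a x x 0.
Proof.
  split.
  - intros t [n ->]. rewrite metric_refl. lra.
  - intros b Hb. apply Hb. exists 0%nat. rewrite metric_refl. ring.
Qed.

Lemma ds_open_proj (V : linf d -> Prop) (x y : linf d) :
  ds_open d a V -> proj1_sig x = proj1_sig y -> V y -> V x.
Proof.
  intros HV Hxy Vy. destruct (HV y Vy) as [r [Hr Hball]].
  apply Hball. exists 0. split; [| lra]. rewrite Hxy. apply ds_is_refl.
Qed.

Definition linf_const (c : X) : linf d.
Proof. exists (fun _ => c). exists 0. intros. rewrite metric_refl. lra. Defined.

Definition update_at (c : X) (n : nat) (p : X) : nat -> X :=
  fun k => if Nat.eqb k n then p else c.

Lemma bounded_update_at (c : X) (n : nat) (p : X) : bounded_seq d (update_at c n p).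
Proof.
  destruct Hd as [Hge _]. exists (d c p + d p c).
  pose proof (Hge c p). pose proof (Hge p c). pose proof (metric_refl p). pose proof (metric_refl c).
  intros k m. unfold update_at. destruct (Nat.eqb k n), (Nat.eqb m n); lra.
Qed.

Lemma basic_nbhd_contains_ds_ball (x : nat -> X) (F : list (nat * (X -> Prop))) :
  (forall iO, In iO F -> metric_open d (snd iO) /\ snd iO (x (fst iO))) ->
  exists r, 0 < r /\ forall y : nat -> X, (forall n, a n * d (x n) (y n) < r) ->
    forall iO, In iO F -> snd iO (y (fst iO)).
Proof.
  induction F as [| [i O] F IH]; intros HF.
  - exists 1. split; [lra |]. intros y _ iO [].
  - destruct IH as [r [Hr Hy]]; [intros iO HiO; apply HF; now right |].
    destruct (HF (i, O) (or_introl eq_refl)) as [Hop Hx]. simpl in Hop, Hx.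
    destruct (Hop _ Hx) as [r0 [Hr0 Hball]].
    exists (Rmin r (a i * r0)). split.
    + apply Rmin_pos; [lra |]. now apply Rmult_lt_0_compat.
    + pose proof (Rmin_l r (a i * r0)). pose proof (Rmin_r r (a i * r0)).
      intros y Hall iO [<- | HiO].
      * simpl. apply Hball, (Rmult_lt_reg_l (a i)); [apply Hapos |]. specialize (Hall i). lra.
      * apply Hy; [| exact HiO]. intro n. specialize (Hall n). lra.
Qed.

Lemma tychonoff_open_ds_open (V : linf d -> Prop) : tychonoff_open d V -> ds_open d a V.
Proof.
  intros [U [HU HV]] x Vx. apply HV in Vx. destruct (HU _ Vx) as [F [HF HFU]].
  destruct (basic_nbhd_contains_ds_ball _ F HF) as [r [Hr Hy]].
  exists r. split; [exact Hr |]. intros y [s [Hs Hsr]].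
  apply HV, HFU, Hy. intro n. pose proof (ds_is_ge _ _ _ n Hs). lra.
Qed.

Lemma weighted_tail_small (M r : R) : Un_cv a 0 -> (forall x y, d x y <= M) -> 0 < r ->
  exists N, forall n p q, (N <= n)%nat -> a n * d p q <= r.
Proof.
  intros Hcv HM Hr.
  set (K := Rabs M + 1).
  assert (HK : 0 < K) by (pose proof (Rabs_pos M); unfold K; lra).
  destruct (Hcv (r / K)) as [N HN]; [now apply Rdiv_lt_0_compat |].
  exists N. intros n p q Hn.
  specialize (HN n Hn). unfold R_dist in HN.
  rewrite Rminus_0_r, Rabs_right in HN by (pose proof (Hapos n); lra).
  assert (HdK : d p q <= K) by (pose proof (HM p q); pose proof (Rle_abs M); unfold K; lra).
  assert (Hbound : a n * d p q <= a n * K)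
    by (apply Rmult_le_compat_l; [pose proof (Hapos n) |]; lra).
  assert (HaK : a n * K <= r / K * K) by (apply Rmult_le_compat_r; lra).
  replace (r / K * K) with r in HaK by (field; lra). lra.
Qed.

Lemma ds_open_tychonoff_open (M : R) (V : linf d -> Prop) :
  Un_cv a 0 -> (forall x y, d x y <= M) -> ds_open d a V -> tychonoff_open d V.
Proof.
  intros Hcv HM HV.
  exists (fun z => exists y : linf d, proj1_sig y = z /\ V y). split.
  - intros z [y0 [<- Vy0]].
    destruct (HV _ Vy0) as [r [Hr Hball]].
    destruct (weighted_tail_small M (r / 2) Hcv HM) as [N HN]; [lra |].
    set (box k := (k, fun q => d (proj1_sig y0 k) q < r / (2 * a k))).
    exists (map box (seq 0 N)). split.
    + intros iO HiO. apply in_map_iff in HiO as [k [<- _]]. simpl. split.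
      * apply metric_open_ball.
      * rewrite metric_refl. pose proof (Hapos k). apply Rdiv_lt_0_compat; lra.
    + intros w Hw.
      assert (Hwb : bounded_seq d w) by (exists M; intros; apply HM).
      exists (exist _ w Hwb). split; [reflexivity |]. apply Hball.
      destruct (ds_is_exists_le (proj1_sig y0) w (r / 2)) as [s [Hs Hsr]];
        [| exists s; split; [exact Hs | lra]].
      intro n. destruct (Compare_dec.lt_dec n N) as [Hlt | Hge]; [| apply HN; lia].
      assert (Hin : In (box n) (map box (seq 0 N)))
        by (apply in_map; apply in_seq; lia).
      specialize (Hw _ Hin). simpl in Hw. pose proof (Hapos n).
      apply (Rmult_lt_compat_l (a n)) in Hw; [| lra].
      replace (a n * (r / (2 * a n))) with (r / 2) in Hw by (field; lra). lra.
  - intros x. split.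
    + intros Vx. now exists x.
    + intros [y [Hyx Vy]]. apply (ds_open_proj V x y HV); [now symmetry | exact Vy].
Qed.

Definition far_at_infinity (c : X) (rho : R) : Prop :=
  forall N, exists n p, (N <= n)%nat /\ rho <= a n * d c p.

Definition ds_center_ball (c : X) (rho : R) : linf d -> Prop :=
  fun y => exists s, s < rho /\ forall n, a n * d c (proj1_sig y n) <= s.

Lemma ds_center_ball_open (c : X) (rho : R) : ds_open d a (ds_center_ball c rho).
Proof.
  destruct Hd as [_ [_ [_ Htri]]].
  intros y [s [Hs Hb]]. exists (rho - s). split; [lra |].
  intros z [t [Ht Htr]]. exists (s + t). split; [lra |]. intro n.
  pose proof (Hb n). pose proof (ds_is_ge _ _ _ n Ht).
  pose proof (Htri c (proj1_sig y n) (proj1_sig z n)).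
  assert (a n * d c (proj1_sig z n)
          <= a n * (d c (proj1_sig y n) + d (proj1_sig y n) (proj1_sig z n)))
    by (apply Rmult_le_compat_l; [pose proof (Hapos n) |]; lra).
  lra.
Qed.

Definition max_index {A : Type} (F : list (nat * A)) : nat :=
  fold_right (fun iO m => Nat.max (fst iO) m) 0%nat F.

Lemma max_index_ge {A : Type} (F : list (nat * A)) (iO : nat * A) :
  In iO F -> (fst iO <= max_index F)%nat.
Proof.
  induction F as [| b F IH]; simpl; intros H; [destruct H |].
  destruct H as [<- | H]; [lia |]. specialize (IH H). lia.
Qed.

Lemma far_center_ball_not_tychonoff_open (c : X) (rho : R) :
  0 < rho -> far_at_infinity c rho -> ~ tychonoff_open d (ds_center_ball c rho).
Proof.
  intros Hrho Hfar [U [HU HV]].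
  assert (Uc : U (proj1_sig (linf_const c))).
  { apply HV. exists 0. split; [exact Hrho |]. intro n. simpl. rewrite metric_refl. lra. }
  destruct (HU _ Uc) as [F [HF HFU]].
  destruct (Hfar (S (max_index F))) as [n [p [Hn Hp]]].
  assert (Uy : U (proj1_sig (exist _ (update_at c n p) (bounded_update_at c n p) : linf d))).
  { apply HFU. intros iO HiO. simpl. unfold update_at.
    destruct (Nat.eqb_spec (fst iO) n) as [Heq | _].
    - pose proof (max_index_ge F iO HiO). lia.
    - exact (proj2 (HF _ HiO)). }
  apply HV in Uy. destruct Uy as [s [Hs Hb]]. specialize (Hb n). simpl in Hb.
  unfold update_at in Hb. rewrite Nat.eqb_refl in Hb. lra.
Qed.

Lemma far_at_infinity_of_not_cv (u v : X) :
  u <> v -> ~ Un_cv a 0 -> exists rho, 0 < rho /\ far_at_infinity u rho.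
Proof.
  intros Huv Hncv. pose proof (metric_pos u v Huv) as Hduv.
  apply not_all_ex_not in Hncv as [eps Heps].
  apply imply_to_and in Heps as [Heps Hn].
  exists (eps * d u v). split; [now apply Rmult_lt_0_compat |].
  intro N. pose proof (not_ex_all_not _ _ Hn N) as HN.
  apply not_all_ex_not in HN as [n Hlt]. apply imply_to_and in Hlt as [Hge Hlt].
  exists n, v. split; [lia |].
  unfold R_dist in Hlt. rewrite Rminus_0_r, Rabs_right in Hlt by (pose proof (Hapos n); lra).
  apply Rmult_le_compat_r; lra.
Qed.

Lemma far_at_infinity_of_unbounded (c : X) : ~ metric_bounded d -> far_at_infinity c 1.
Proof.
  destruct Hd as [_ [_ [Hsym Htri]]]. intros Hnb N.
  pose proof (Hapos N) as HaN.
  assert (Hxy : exists x y, 2 / a N < d x y).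
  { apply NNPP. intros Hno. apply Hnb. exists (2 / a N). intros x y.
    apply Rnot_lt_le. intro Hlt. apply Hno. eauto. }
  destruct Hxy as [x [y Hxy]].
  (* d x y <= d c x + d c y, so one of c x, c y is at distance >= 1 / a N *)
  pose proof (Htri x c y) as Hcxy. rewrite (Hsym x c) in Hcxy.
  assert (Hinv : a N * (1 / a N) = 1) by (field; lra).
  assert (Htwo : 2 / a N = 2 * (1 / a N)) by (field; lra).
  destruct (Rle_lt_dec (1 / a N) (d c x)) as [Hx | Hx];
    [exists N, x | exists N, y]; (split; [lia |]);
    rewrite <- Hinv; apply Rmult_le_compat_l; lra.
Qed.

End SupMetricTopology.

(* The bound on (a_n) only serves to make d_s a finite-valued metric; the frozen
   definition of ds_open works with suprema directly. *)
Theorem mainTheorem2 (X : Type) (d : X -> X -> R) (a : nat -> R)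
  (Hd : is_metric d)
  (Hns : exists x y : X, x <> y)
  (Hapos : forall n, 0 < a n)
  (Habd : exists M : R, forall n, a n <= M) :
  (forall V : linf d -> Prop, tychonoff_open d V <-> ds_open d a V)
  <-> (Un_cv a 0 /\ metric_bounded d).
Proof.
  destruct Hns as [u [v Huv]]. split.
  - intros Heq.
    assert (Hfar_fails : forall c rho, 0 < rho -> ~ far_at_infinity d a c rho).
    { intros c rho Hrho Hfar.
      apply (far_center_ball_not_tychonoff_open d a Hd c rho Hrho Hfar), Heq.
      now apply ds_center_ball_open. }
    split; apply NNPP.
    + intros Hncv.
      destruct (far_at_infinity_of_not_cv d a Hd Hapos u v Huv Hncv) as [rho [Hrho Hfar]].
      exact (Hfar_fails u rho Hrho Hfar).
    + intros Hnb.
      exact (Hfar_fails u 1 Rlt_0_1 (far_at_infinity_of_unbounded d a Hd Hapos u Hnb)).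
  - intros [Hcv [M HM]] V. split.
    + now apply tychonoff_open_ds_open.
    + now apply (ds_open_tychonoff_open d a Hd Hapos M).
Qed.
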